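(* Suppose a Conway $99$-graph $\Delta$ exists, that is, a strongly regular graph with parameters $(99,14,1,2)$, and let $x\in\operatorname{Aut}(\Delta)$ have order $3$. Then either $\operatorname{Fix}(x)=\varnothing$ and $a_1(x)=18$, or $\operatorname{Fix}(x)\cong K_3$ and $a_1(x)=6$.
   Context: A strongly regular graph with parameters $(v,k,\lambda,\mu)$ is a finite simple $k$-regular graph on $v$ vertices in which any two adjacent vertices have exactly $\lambda$ common neighbours and any two distinct non-adjacent vertices have exactly $\mu$ common neighbours. For an automorphism $x$ of $\Delta$, $\operatorname{Fix}(x)$ is the subgraph induced on the vertices fixed by $x$ (with $\operatorname{Fix}(x)=\varnothing$ meaning that $x$ fixes no vertex), and $a_1(x)=|\{u\in V(\Delta):u\sim x(u)\}|$ is the number of vertices adjacent to their image under $x$. $K_3$ is the triangle. *)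

(* Defs.v *)
From HB Require Import structures.
From mathcomp Require Import all_boot all_fingroup.

Set Implicit Arguments.
Unset Strict Implicit.
Unset Printing Implicit Defensive.

Local Open Scope group_scope.

Record sgraph := SGraph {
  vertex :> finType;
  adj : rel vertex;
  adj_sym : symmetric adj;
  adj_irrefl : irreflexive adj }.

Definition neighbours (G : sgraph) (u : G) : {set G} := [set w | adj u w].

Definition strongly_regular (G : sgraph) (v k lambda mu : nat) : Prop :=
  [/\ #|G| = v,
      forall u : G, #|neighbours u| = k,
      forall u w : G, adj u w ->
        #|neighbours u :&: neighbours w| = lambda
    & forall u w : G, u != w -> ~~ adj u w ->
        #|neighbours u :&: neighbours w| = mu].

Definition graph_iso (G H : sgraph) : Prop :=
  exists2 f : G -> H, bijective f & forall u w, adj (f u) (f w) = adj u w.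

Definition graph_aut (G : sgraph) : {set {perm G}} :=
  [set s : {perm G} | [forall u, forall w, adj (s u) (s w) == adj u w]].

Section Induced.
Variables (G : sgraph) (A : {set G}).

Definition induced_adj : rel {u : G | u \in A} :=
  fun u w => adj (val u) (val w).

Lemma induced_adj_sym : symmetric induced_adj.
Proof. by move=> u w; rewrite /induced_adj adj_sym. Qed.

Lemma induced_adj_irrefl : irreflexive induced_adj.
Proof. by move=> u; rewrite /induced_adj adj_irrefl. Qed.

Definition induced : sgraph := SGraph induced_adj_sym induced_adj_irrefl.
End Induced.

Section Complete.
Variable n : nat.

Definition complete_adj : rel 'I_n := fun i j => i != j.

Lemma complete_adj_sym : symmetric complete_adj.
Proof. by move=> i j; rewrite /complete_adj eq_sym. Qed.

Lemma complete_adj_irrefl : irreflexive complete_adj.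
Proof. by move=> i; rewrite /complete_adj eqxx. Qed.

Definition complete : sgraph := SGraph complete_adj_sym complete_adj_irrefl.
End Complete.

Definition fixed_vertices (G : sgraph) (x : {perm G}) : {set G} := 'Fix_'P[x].

Definition fixed_graph (G : sgraph) (x : {perm G}) : sgraph :=
  induced (fixed_vertices x).

Definition a1 (G : sgraph) (x : {perm G}) : nat := #|[set u : G | adj u (x u)]|.

(* Main.v *)
Require Import Defs.
From mathcomp Require Import all_boot all_order all_fingroup all_algebra.
From mathcomp Require Import all_solvable.
From mathcomp Require Import zify ring lra.

(** Let F be the set of fixed vertices and T the set of vertices adjacent to
    their image, so that a_1(x) = |T|. Since adjacent vertices have one common
    neighbour, every edge lies in a unique triangle, called a line here; there
    are 231 lines, and the 14 neighbours of a vertex are paired by the 7 lines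
    through it.

    Fixed vertices. Two vertices never have three common neighbours, so a
    vertex with two fixed neighbours is itself fixed. The number of fixed
    neighbours of a fixed vertex is even and congruent to 14 modulo 3, hence
    2, 8 or 14. The value 2 forces F to be a line, 14 forces x = 1, and 8
    everywhere is impossible by counting the edges that leave F
    ([fixed_set_empty_or_line]).

    Two congruences. If A is the adjacency matrix, P the permutation matrix of
    x and J the all-ones matrix, then P(A - 3) - 4J has square zero modulo 7,
    so its trace vanishes modulo 7: |T| = 3|F| + 4 mod 7 ([trace_mod7]). When
    F is empty or a line, the lines mapped to themselves number (|T| + |F|)/3,
    which is congruent to 231 modulo 3, so |T| + |F| = 0 mod 9
    ([card_T_fixed_mod9]). If F is a line these leave |T| = 6 or 69, and the
    36 vertices joined to F lie outside T, which leaves 6. If F is empty they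
    leave |T| = 18 or 81.

    The case F empty, |T| = 81. Now 18 vertices lie outside T, too few for
    every line with two vertices of T in different orbits to end outside T.
    Hence some line u, v, z consists of vertices of T in three different
    orbits. These orbits are lines too and together form a 3 x 3 grid H, and
    each vertex outside a grid has exactly one neighbour in it
    ([card_neighbours_in_grid]). The matrix 27 - 9A + J is positive
    semidefinite, and Bessel's inequality for its Gram vectors, averaged over
    orbits, shows that at most 4 of the 5 lines that leave the grid at a
    vertex h contain a vertex of T ([outer_independent]). So h has at most 8
    neighbours in T outside H. There are 9 grid vertices and 81 - 9 = 72
    vertices of T to be reached, so equality holds throughout, and exactly one
    line {h, z, z'} leaves h with z and z' outside T. Counting common
    neighbours of h and x(z) shows that z' is adjacent to the whole orbit of
    z, so the vertices z and x(z) have three common neighbours, a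
    contradiction ([no_transversal_line]). *)

Set Implicit Arguments.
Unset Strict Implicit.
Unset Printing Implicit Defensive.

(** * Graphs with lambda = 1 and mu = 2 *)
Section CommonNeighbours.
Variables (G : sgraph) (v k : nat).
Hypothesis srg : strongly_regular G v k 1 2.
Implicit Types u w a b : G.

Lemma adj_neq u w : adj u w -> u != w.
Proof. by apply: contraTneq => ->; rewrite adj_irrefl. Qed.

Lemma card_neighbours u : #|neighbours u| = k.
Proof. by case: srg. Qed.

Lemma card_common u w :
  #|neighbours u :&: neighbours w| =
    if u == w then k else if adj u w then 1 else 2.
Proof.
case: srg => _ hk hl hm; case: eqVneq => [->|uw]; first by rewrite setIid hk.
by case: ifP => [/hl|/negbT/(hm _ _ uw)].
Qed.

Lemma adj_common_unique u w a b :
  adj u w -> adj u a -> adj w a -> adj u b -> adj w b -> a = b.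
Proof.
move=> uw ua wa ub wb; have := card_common u w.
rewrite (negPf (adj_neq uw)) uw => /eqP/cards1P[c E].
have: a \in [set c] by rewrite -E !inE ua.
have: b \in [set c] by rewrite -E !inE ub.
by rewrite !inE => /eqP-> /eqP->.
Qed.

Lemma no_three_common u w a b c : u != w ->
  adj u a -> adj w a -> adj u b -> adj w b -> adj u c -> adj w c ->
  a != b -> a != c -> b != c -> False.
Proof.
move=> uw ua wa ub wb uc wc ab ac bc.
have: #|[set a; b; c]| <= #|neighbours u :&: neighbours w|.
  apply/subset_leq_card/subsetP => d; rewrite !inE.
  by case/orP=> [/orP[]|] /eqP->; apply/andP.
rewrite card_common (negPf uw) -setUA cardsU1 cards2 !inE.
by rewrite (negPf ab) (negPf ac) bc; case: ifP.
Qed.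

Lemma other_common u w a : u != w -> ~~ adj u w -> adj u a -> adj w a ->
  exists b, [/\ b != a, adj u b & adj w b].
Proof.
move=> uw nuw ua wa; have := card_common u w.
rewrite (negPf uw) (negPf nuw) (cardsD1 a) !inE ua wa => -[] /eqP/cards1P[b E].
have: b \in [set b] by rewrite inE.
by rewrite -E !inE => /and3P[ba ub wb]; exists b.
Qed.

Lemma two_common u w : u != w -> ~~ adj u w ->
  exists a b, [/\ a != b, adj u a, adj w a, adj u b & adj w b].
Proof.
move=> uw nuw; have := card_common u w.
rewrite (negPf uw) (negPf nuw) => /eqP/cards2P[a [b [ab E]]].
have: a \in [set a; b] by rewrite !inE eqxx.
have: b \in [set a; b] by rewrite !inE eqxx orbT.
rewrite -E !inE => /andP[ub wb] /andP[ua wa].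
by exists a, b; split.
Qed.

(** The third vertex of the line through u and w when these are adjacent. *)
Definition apex u w : G := odflt u [pick a in neighbours u :&: neighbours w].

Lemma apexP u w : adj u w -> adj u (apex u w) /\ adj w (apex u w).
Proof.
move=> uw; rewrite /apex; case: pickP => [a|h]; first by rewrite !inE => /andP.
have := card_common u w; rewrite (negPf (adj_neq uw)) uw eq_card0 //.
Qed.

Lemma apex_unique u w a : adj u w -> adj u a -> adj w a -> apex u w = a.
Proof. by move=> uw; case: (apexP uw) => *; apply: (adj_common_unique uw). Qed.

Lemma apexK u w : adj u w -> apex u (apex u w) = w.
Proof.
by move=> uw; case: (apexP uw) => *; apply: apex_unique; rewrite // adj_sym.
Qed.

Lemma double_count (A B : {set G}) :
  \sum_(u in A) #|neighbours u :&: B| = \sum_(w in B) #|neighbours w :&: A|.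
Proof.
have h (C D : {set G}) : \sum_(u in C) #|neighbours u :&: D| =
    \sum_(u in C) \sum_(w in D) adj u w.
  apply: eq_bigr => u _; rewrite -sum1_card big_mkcond /= [RHS]big_mkcond /=.
  by apply: eq_bigr => w _; rewrite !inE; case: adj; case: (w \in D).
rewrite !h exchange_big; apply: eq_bigr => u _; apply: eq_bigr => w _.
by rewrite adj_sym.
Qed.

(** The lines through u pair its neighbours by the involution [apex u]. Taking
    from each pair that meets S one member of S leaves an independent set, which
    has at least half as many elements as S, and exactly half when S is a union
    of pairs. This serves both for parity arguments and for bounding S through
    its independent subsets. *)
Lemma partner_transversal u (S : {set G}) : S \subset neighbours u ->
  exists I : {set G}, [/\ I \subset S,
    {in I &, forall p p', ~~ adj p p'},
    #|S| <= 2 * #|I|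
  & ({in S, forall p, apex u p \in S}) <-> #|S| = 2 * #|I|].
Proof.
move=> /subsetP SN.
(* In a pair contained in S, keep the member of smaller rank. *)
pose I := [set p in S |
  (apex u p \in S) ==> (enum_rank p < enum_rank (apex u p))].
have adjS p : p \in S -> adj u p by move=> /SN; rewrite inE.
have IS : I \subset S by apply/subsetP => p; rewrite inE => /andP[].
have inI p : p \in S -> (p \in I) || (apex u p \in I).
  move=> pS; rewrite !inE pS /=; case: (boolP (apex u p \in S)) => //= qS.
  rewrite (apexK (adjS _ pS)) pS /=; case: ltngtP => // e.
  have /adj_neq : adj p (apex u p) by case: (apexP (adjS _ pS)).
  by rewrite -(inj_eq enum_rank_inj) -val_eqE /= e eqxx.
have apexI : {in S &, injective (apex u)}.
  by move=> p q /adjS up /adjS uq e; rewrite -(apexK up) e apexK.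
have indep : {in I &, forall p p', ~~ adj p p'}.
  move=> p q; rewrite !inE => /andP[pS hp] /andP[qS hq]; apply/negP => pq.
  have e : apex u p = q by apply: apex_unique => //; apply: adjS.
  have e' : apex u q = p by rewrite -e apexK // adjS.
  by move: hp hq; rewrite e e' pS qS /=; case: ltngtP.
have cardI : #|[set apex u p | p in I]| = #|I|.
  apply: card_in_imset => p q /(subsetP IS) ? /(subsetP IS); exact: apexI.
have disj : I :&: [set apex u p | p in I] = set0.
  apply/setP => p; rewrite in_set0; apply/negbTE/negP.
  move=> /setIP[pI /imsetP[q qI e]].
  have qS := subsetP IS _ qI; case: (apexP (adjS _ qS)) => _.
  by rewrite -e; apply/negP/indep.
have cov : S \subset I :|: [set apex u p | p in I].
  apply/subsetP => p pS; case/orP: (inI p pS) => [pI|qI].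
    by rewrite inE pI.
  rewrite inE; apply/orP; right; apply/imsetP; exists (apex u p) => //.
  by rewrite apexK // adjS.
have cU : #|I :|: [set apex u p | p in I]| = 2 * #|I|.
  by rewrite cardsU disj cards0 cardI subn0 mul2n addnn.
exists I; split=> //; first by rewrite -cU subset_leq_card.
split=> [cl|e p pS].
  apply/eqP; rewrite -cU eqn_leq !subset_leq_card //.
  apply/subsetP => p; rewrite inE => /orP[/(subsetP IS)//|].
  move=> /imsetP[q /(subsetP IS) qS ->].
  exact: cl.
have: S == I :|: [set apex u p | p in I] by rewrite eqEcard cov cU e leqnn.
move/eqP => E; move: pS; rewrite E => /setUP[pI|/imsetP[q qI ->]].
  by rewrite inE; apply/orP; right; apply: imset_f.
by rewrite apexK ?adjS ?(subsetP IS) // inE qI.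
Qed.

End CommonNeighbours.

Lemma fixed_verticesE (G : sgraph) (x : {perm G}) u :
  (u \in fixed_vertices x) = (x u == u).
Proof. by apply/afix1P/eqP. Qed.

(** * The trace congruence *)
Section Trace.
Import GRing.Theory.
Local Open Scope ring_scope.

(** In a rank factorization A = C R the relation C (R C) R = 0 forces R C = 0,
    and A has the same trace as R C. *)
Lemma mxtrace_square_zero (F : fieldType) n (A : 'M[F]_n) :
  A *m A = 0 -> \tr A = 0.
Proof.
move=> A2; rewrite -[A]mulmx_base mxtrace_mulC.
suff -> : row_base A *m col_base A = 0 by rewrite mxtrace0.
apply/eqP; rewrite -(mulmx_free_eq0 _ (row_base_free A)).
apply/eqP/(row_full_inj (col_base_full A)).
by rewrite mulmx0 -mulmxA mulmx_base mulmxA mulmx_base.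
Qed.

Lemma sum_diag_square_zero (F : fieldType) (T : finType) (f : T -> T -> F) :
  (forall u w, \sum_v f u v * f v w = 0) -> \sum_u f u u = 0.
Proof.
move=> f2; pose A := \matrix_(i < #|T|, j < #|T|) f (enum_val i) (enum_val j).
have /mxtrace_square_zero : A *m A = 0.
  apply/matrixP => i j.
  rewrite [RHS]mxE -(f2 (enum_val i) (enum_val j)) [LHS]mxE.
  rewrite [RHS](reindex _ (onW_bij _ (enum_val_bij T))).
  by apply: eq_bigr => l _; rewrite !mxE.
move=> trA; rewrite -[RHS]trA (reindex _ (onW_bij _ (enum_val_bij T))).
by apply: eq_bigr => i _; rewrite mxE.
Qed.

Variable G : sgraph.
Hypothesis srg : strongly_regular G 99 14 1 2.

Lemma card_conway : #|G| = 99%N. Proof. by case: srg. Qed.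

Lemma sum_adj (R : pzRingType) (u : G) : \sum_w (adj u w)%:R = 14%:R :> R.
Proof.
rewrite -natr_sum -(card_neighbours srg u) -sum1_card [in RHS]big_mkcond /=.
by congr _%:R; apply: eq_bigr => w _; rewrite inE; case: adj.
Qed.

(** The matrix identity A^2 = 12 I - A + 2 J. *)
Lemma sum_adj_adj (R : comPzRingType) (u w : G) :
  \sum_v (adj u v)%:R * (adj v w)%:R =
    2%:R + 12%:R * (u == w)%:R - (adj u w)%:R :> R.
Proof.
have -> : \sum_v (adj u v)%:R * (adj v w)%:R =
    #|neighbours u :&: neighbours w|%:R :> R.
  rewrite -sum1_card natr_sum [RHS]big_mkcond /=; apply: eq_bigr => v _.
  by rewrite !inE [adj v w]adj_sym -natrM mulnb; case: (_ && _).
rewrite (card_common srg); case: eqVneq => [->|_].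
  by rewrite adj_irrefl mulr1 subr0 -natrD.
rewrite mulr0 addr0; case: adj; last by rewrite subr0.
by rewrite -natrB.
Qed.

Lemma sum_delta_l (R : pzSemiRingType) (T : finType) (a : T) (f : T -> R) :
  \sum_v (a == v)%:R * f v = f a.
Proof.
rewrite (bigD1 a) //= eqxx mul1r big1 ?addr0 // => v /negPf va.
by rewrite eq_sym va mul0r.
Qed.

Lemma sum_delta_r (R : pzSemiRingType) (T : finType) (a : T) (f : T -> R) :
  \sum_v f v * (v == a)%:R = f a.
Proof.
rewrite (bigD1 a) //= eqxx mulr1 big1 ?addr0 // => v /negPf va.
by rewrite va mulr0.
Qed.

(** With N = A - 3 I one has N^2 = 2 J and N J = 4 J modulo 7, and J^2 = J as
    99 = 1 modulo 7. As P commutes with N and fixes J, the matrix P N - 4 J has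
    square 2 J - 32 J + 16 J = 0 modulo 7. Its trace is
    |T| - 3 |F| - 4 * 99. *)
Lemma trace_mod7 (x : {perm G}) : x \in graph_aut G ->
  a1 x = 3 * #|fixed_vertices x| + 4 %[mod 7].
Proof.
rewrite inE => /forallP hx.
have xadj u v : adj (x u) (x v) = adj u v.
  by move/forallP: (hx u) => /(_ v)/eqP.
pose F : fieldType := 'F_7.
pose a (u v : G) : F := (adj u v)%:R.
pose d (u v : G) : F := (u == v)%:R.
pose f u v : F := a (x u) v - 3%:R * d (x u) v - 4%:R.
have nF (n : nat) : n%:R = (n %% 7)%:R :> F.
  apply/val_inj; rewrite /= !val_Fp_nat //= modn_mod //.
have e7 : 7%:R = 0 :> F by rewrite nF.
have f2 u w : \sum_v f u v * f v w = 0.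
  pose w' := (x^-1)%g w.
  have fw v : f v w = a v w' - 3%:R * d v w' - 4%:R.
    rewrite /f /a /d -{1 2}[w](permKV x) -/w' xadj.
    by rewrite (inj_eq perm_inj).
  pose u' := x u.
  transitivity (\sum_v (a u' v * a v w' - 3%:R * (a u' v * d v w') - 4%:R * a u' v
     - 3%:R * (d u' v * a v w') + 9%:R * (d u' v * d v w') + 12%:R * d u' v
     - 4%:R * a v w' + 12%:R * d v w' + 16%:R)).
    by apply: eq_bigr => v _; rewrite fw /f -/u'; ring.
  rewrite !(big_split, sumrN) /= -!mulr_sumr sum_adj_adj.
  rewrite (sum_delta_r w' (a u')) (sum_delta_l u' (a^~ w')).
  rewrite (sum_delta_l u' (d^~ w')).
  rewrite sum_adj sumr_const card_conway.
  have -> : \sum_v d u' v = 1.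
    by rewrite -(sum_delta_l u' (fun=> 1)); apply: eq_bigr => v _; rewrite mulr1.
  have -> : \sum_v d v w' = 1.
    by rewrite -(sum_delta_r w' (fun=> 1)); apply: eq_bigr => v _; rewrite mul1r.
  have -> : \sum_v a v w' = 14%:R.
    by rewrite -(sum_adj _ w'); apply: eq_bigr => v _; rewrite /a adj_sym.
  rewrite -/(a u' w') -/(d u' w') -mulr_natr.
  transitivity (7%:R * (214%:R + 3%:R * d u' w' - a u' w')).
    by ring.
  by rewrite e7 mul0r.
have := sum_diag_square_zero f2; rewrite /f !(big_split, sumrN) /= -mulr_sumr.
rewrite sumr_const card_conway.
have -> : \sum_u a (x u) u = (a1 x)%:R.
  rewrite /a1 -sum1_card natr_sum [RHS]big_mkcond /=; apply: eq_bigr => u _.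
  by rewrite inE /a adj_sym; case: adj.
have -> : \sum_u d (x u) u = #|fixed_vertices x|%:R.
  rewrite -sum1_card natr_sum [RHS]big_mkcond /=; apply: eq_bigr => u _.
  by rewrite fixed_verticesE /d; case: eqP.
rewrite -!natrD -natrM -addrA -opprD -natrD => /eqP.
rewrite subr_eq0 => /eqP/(congr1 val); rewrite /= !val_Fp_nat // => ->.
by rewrite -modnDmr.
Qed.
End Trace.

(** * Bessel's inequality for the eigenvalue -4 *)
Section Kernel.
Import Order.TTheory GRing.Theory Num.Theory.
Local Open Scope ring_scope.

Definition psd_kernel (V : finType) (K : V -> V -> int) :=
  forall c : V -> int, 0 <= \sum_u \sum_v K u v * (c u * c v).

(** Read K as the Gram matrix of vectors of norm 12. Project q and the
    elements of S onto the orthogonal complement of the plane of h and k: q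
    becomes q + k/2 and p in S becomes p + h/2. The images all have norm 9, those
    of S are mutually orthogonal, and each has inner product 9/2 or -9/2 with
    that of q, so Bessel's inequality gives |S| * (9/2)^2 / 9 <= 9. *)
Lemma bessel_bound (V : finType) (K : V -> V -> int) (h k q : V) (S : {set V}) :
  psd_kernel K -> (forall u v, K u v = K v u) ->
  K h h = 12 -> K k k = 12 -> K q q = 12 ->
  K h k = - 6 -> K q k = - 6 -> K q h = 3 ->
  {in S, forall p, [/\ K h p = - 6, K k p = 3 & K q p = - 6 \/ K q p = 3]} ->
  {in S &, forall p p', K p p' = if p == p' then 12 else 3} ->
  (#|S| <= 4)%N.
Proof.
move=> posK sym hh kk qq hk qk qh hS SS.
pose e p : int := if K q p == 3 then 1 else -1.
pose s := \sum_(p in S) e p; pose n : int := #|S|%:R.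
(* These are the coordinates of twice the vector 2 q' - \sum_p (e p) p',
   where a prime denotes the projection and e p is the sign of the inner product
   of q' and p'. *)
pose c v : int := 4 * (q == v)%:R + 2 * (k == v)%:R - s * (h == v)%:R
  - 2 * (if v \in S then e v else 0).
have ev (f : V -> int) : \sum_v f v * c v =
    4 * f q + 2 * f k - s * f h - 2 * \sum_(p in S) f p * e p.
  have -> : \sum_(p in S) f p * e p = \sum_v (if v \in S then e v else 0) * f v.
    rewrite big_mkcond; apply: eq_bigr => v _.
    by case: ifP; rewrite ?mul0r 1?mulrC.
  rewrite -(sum_delta_l q f) -(sum_delta_l k f) -(sum_delta_l h f) !mulr_sumr.
  by rewrite -!sumrN -!big_split; apply: eq_bigr => v _ /=; rewrite /c; ring.
have sumc (a : int) : \sum_(p in S) a * e p = a * s by rewrite mulr_sumr.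
have ee p : e p * e p = 1 by rewrite /e; case: ifP.
pose g u := \sum_v K u v * c v.
have A2 : 2 * (\sum_(p in S) K q p * e p) = 9 * n - 3 * s.
  rewrite /s /n -sumr_const !mulr_sumr -sumrB; apply: eq_bigr => p pS.
  by have [_ _ []] := hS p pS; rewrite /e => ->.
have gq : g q = 36 - 9 * n by rewrite /g ev qq qk qh A2; ring.
have gk : g k = 0.
  rewrite /g ev kk (sym k q) qk (sym k h) hk.
  under eq_bigr => p pS do (have [_ -> _] := hS p pS).
  by rewrite sumc; ring.
have gh : g h = 0.
  rewrite /g ev hh (sym h q) qh hk.
  under eq_bigr => p pS do (have [-> _ _] := hS p pS).
  by rewrite sumc; ring.
have gS : \sum_(p in S) g p * e p = 0.
  transitivity (\sum_(p in S) (4 * (K q p * e p) + 6 * e p - 18)).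
    apply: eq_bigr => p pS; have [hp kp _] := hS p pS.
    rewrite /g ev (sym p q) (sym p k) (sym p h) hp kp.
    have -> : \sum_(p' in S) K p p' * e p' = 3 * s + 9 * e p.
      rewrite /s (bigD1 p) //= [\sum_(i in S) e i](bigD1 p) //= SS // eqxx.
      have -> : \sum_(i in S | i != p) K p i * e i =
          3 * \sum_(i in S | i != p) e i.
        rewrite mulr_sumr; apply: eq_bigr => i /andP[iS ip].
        by rewrite SS // eq_sym (negPf ip).
      by ring.
    have <- : 18 * (e p * e p) = 18 by rewrite ee.
    ring.
  rewrite sumrB big_split /= -!mulr_sumr sumr_const -/s -mulr_natr -/n.
  have -> : 4 * \sum_(p in S) K q p * e p = 2 * (9 * n - 3 * s).
    by rewrite -A2; ring.
  ring.
have := posK c.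
have -> : \sum_u \sum_v K u v * (c u * c v) = \sum_u g u * c u.
  apply: eq_bigr => u _; rewrite /g mulr_suml; apply: eq_bigr => v _; ring.
rewrite ev gq gk gh gS /n; lia.
Qed.

Variable G : sgraph.
Hypothesis srg : strongly_regular G 99 14 1 2.

(** The entries of 27 I - 9 A + J, which is 63 times the orthogonal projection
    onto the eigenspace of A for the eigenvalue -4. *)
Definition kernel (u w : G) : int := 27 * (u == w)%:R - 9 * (adj u w)%:R + 1.

Lemma kernel_sym u w : kernel u w = kernel w u.
Proof. by rewrite /kernel eq_sym adj_sym. Qed.

Lemma kernel_square u w : \sum_v kernel u v * kernel v w = 63 * kernel u w.
Proof.
pose a (u v : G) : int := (adj u v)%:R.
pose d (u v : G) : int := (u == v)%:R.
transitivity (\sum_v (729 * (d u v * d v w) - 243 * (d u v * a v w) + 27 * d u v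
   - 243 * (a u v * d v w) + 81 * (a u v * a v w) - 9 * a u v
   + 27 * d v w - 9 * a v w + 1)).
  apply: eq_bigr => v _.
  by rewrite /kernel -/(a _ _) -/(a _ _) -/(d _ _) -/(d _ _); ring.
rewrite !(big_split, sumrN) /= -!mulr_sumr (sum_adj_adj srg).
rewrite (sum_delta_r w (a u)) (sum_delta_l u (a^~ w)) (sum_delta_l u (d^~ w)).
rewrite (sum_adj srg) sumr_const (card_conway srg) -mulr_natr.
have -> : \sum_v d u v = 1.
  by rewrite -(sum_delta_l u (fun=> 1)); apply: eq_bigr => v _; rewrite mulr1.
have -> : \sum_v d v w = 1.
  by rewrite -(sum_delta_r w (fun=> 1)); apply: eq_bigr => v _; rewrite mul1r.
have -> : \sum_v a v w = 14%:R.
  by rewrite -(sum_adj srg _ w); apply: eq_bigr => v _; rewrite /a adj_sym.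
rewrite /kernel -/(a u w) -/(d u w); ring.
Qed.

(** A symmetric matrix M with M^2 = 63 M satisfies 63 (My, y) = |My|^2. *)
Lemma kernel_psd : psd_kernel kernel.
Proof.
move=> y; suff e : 63 * (\sum_u \sum_w kernel u w * (y u * y w)) =
    \sum_v (\sum_u kernel u v * y u) ^+ 2.
  by rewrite -(@pmulr_rge0 _ 63) // e; apply: sumr_ge0 => v _; exact: sqr_ge0.
transitivity (\sum_u \sum_w \sum_v kernel u v * kernel v w * (y u * y w)).
  rewrite mulr_sumr; apply: eq_bigr => u _; rewrite mulr_sumr.
  by apply: eq_bigr => w _; rewrite -mulr_suml kernel_square mulrA.
under eq_bigr => u _ do rewrite exchange_big.
rewrite exchange_big /=; apply: eq_bigr => v _.
rewrite expr2 big_distrl; apply: eq_bigr => u _ /=; rewrite big_distrr.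
by apply: eq_bigr => w _ /=; rewrite (kernel_sym v w); ring.
Qed.

Variable x : {perm G}.
Hypothesis xadj : forall u v, adj (x u) (x v) = adj u v.
Hypothesis xK : forall u, x (x (x u)) = u.

(** A third of the sum of [kernel] over the product of the orbits of u and v, by
    invariance of [kernel] under x. *)
Definition orbit_kernel u v := kernel u v + kernel u (x v) + kernel u (x (x v)).

Lemma kernel_inv u v : kernel (x u) (x v) = kernel u v.
Proof. by rewrite /kernel xadj (inj_eq perm_inj). Qed.

Lemma orbit_kernel_sym u v : orbit_kernel u v = orbit_kernel v u.
Proof.
rewrite /orbit_kernel kernel_sym -addrA [kernel u (x v) + _]addrC addrA.
congr (_ + _ + _); rewrite kernel_sym.
  by rewrite -kernel_inv xK.
by rewrite -[LHS]kernel_inv -[LHS]kernel_inv xK.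
Qed.

(** The form of [orbit_kernel] at c is a third of that of [kernel] at the sum
    of c over orbits. *)
Lemma orbit_kernel_psd : psd_kernel orbit_kernel.
Proof.
move=> c; pose Q a b := \sum_u \sum_w kernel u w * (a u * b w).
have reix (f : G -> int) : \sum_u f (x u) = \sum_u f u.
  rewrite [RHS](reindex x) //; apply/onW_bij.
  by exists (x^-1)%g; [exact: permK | exact: permKV].
have Qx a b : Q (a \o x) (b \o x) = Q a b.
  rewrite /Q -[RHS]reix; apply: eq_bigr => u _; rewrite -[RHS]reix.
  by apply: eq_bigr => w _; rewrite kernel_inv.
have QDl a a' b : Q (fun u => a u + a' u) b = Q a b + Q a' b.
  rewrite /Q -big_split; apply: eq_bigr => u _ /=; rewrite -big_split.
  by apply: eq_bigr => w _ /=; ring.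
have QDr a b b' : Q a (fun u => b u + b' u) = Q a b + Q a b'.
  rewrite /Q -big_split; apply: eq_bigr => u _ /=; rewrite -big_split.
  by apply: eq_bigr => w _ /=; ring.
have Qe a a' b b' : a =1 a' -> b =1 b' -> Q a b = Q a' b'.
  move=> ea eb; apply: eq_bigr => u _; apply: eq_bigr => w _; by rewrite ea eb.
pose c1 := c \o x; pose c2 := c1 \o x.
have c3 : c2 \o x =1 c by move=> u; rewrite /c2 /c1 /= xK.
have S0 : \sum_u \sum_v orbit_kernel u v * (c u * c v) = Q c c + Q c c2 + Q c c1.
  rewrite /Q -!big_split; apply: eq_bigr => u _ /=.
  transitivity (\sum_v (kernel u v * (c u * c v) + kernel u (x v) * (c u * c v)
      + kernel u (x (x v)) * (c u * c v))).
    by apply: eq_bigr => v _; rewrite -!mulrDl.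
  rewrite big_split big_split /=; congr (_ + _ + _).
    by rewrite -[RHS]reix; apply: eq_bigr => w _; rewrite /c2 /c1 /= xK.
  by rewrite -[RHS]reix -[RHS]reix; apply: eq_bigr => w _; rewrite /c1 /= xK.
have := kernel_psd (fun u => c u + c1 u + c2 u).
rewrite -/(Q _ _) !QDl !QDr S0.
have -> : Q c1 c = Q c c2 by rewrite -[RHS]Qx; apply: Qe => // u; rewrite c3.
have -> : Q c1 c1 = Q c c by exact: Qx.
have -> : Q c1 c2 = Q c c1 by exact: Qx.
have -> : Q c2 c = Q c c1.
  by rewrite -[RHS]Qx -[RHS]Qx; apply: Qe => // u; rewrite /= /c1 /= xK.
have -> : Q c2 c1 = Q c c2.
  by rewrite -[RHS]Qx -[RHS]Qx; apply: Qe => // u; rewrite /= /c2 /c1 /= xK.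
have -> : Q c2 c2 = Q c c by rewrite -(Qx c c) -[RHS]Qx.
lra.
Qed.

End Kernel.

(** * Three by three grids *)
Lemma third_ord3 (i j : 'I_3) : exists k, (k != i) && (k != j).
Proof.
have : 0 < #|~: [set i; j]|.
  by have := cardsC [set i; j]; rewrite card_ord cards2; case: eqP; lia.
by case/card_gt0P => k; rewrite !inE negb_or; exists k.
Qed.

Section Grid.
Variable G : sgraph.
Hypothesis srg : strongly_regular G 99 14 1 2.
Variable g : 'I_3 * 'I_3 -> G.
Hypothesis gadj : forall a b, adj (g a) (g b) = (a.1 == b.1) (+) (a.2 == b.2).
Local Notation H := [set g a | a : 'I_3 * 'I_3].

Lemma grid_inj : injective g.
Proof.
move=> [a1 a2] [b1 b2] e; have := gadj (a1, a2) (b1, b2).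
rewrite e adj_irrefl /=; case: eqVneq => [<-|ab1]; first by case: eqVneq => [<-|].
case: eqVneq => // ab2 _; have [c /andP[ca cb]] := third_ord3 a2 b2.
have := gadj (a1, a2) (a1, c); have := gadj (b1, b2) (a1, c).
rewrite -e => -> /=; rewrite eqxx ![_ == c]eq_sym (negPf ca) (negPf cb).
by rewrite eq_sym (negPf ab1).
Qed.

Lemma card_grid : #|H| = 9.
Proof. by rewrite (card_imset _ grid_inj) card_prod card_ord. Qed.

(** Inside a grid two vertices already have all the common neighbours they are
    allowed: one if they are on a grid line, two otherwise. *)
Lemma grid_neighbour_unique p a b :
  p \notin H -> adj p (g a) -> adj p (g b) -> a = b.
Proof.
case: a b => [a1 a2] [b1 b2] pH pa pb; apply/eqP/negPn/negP => ab.
have gne c d : c != d -> g c != g d by rewrite (inj_eq grid_inj).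
have pne c : g c != p by apply: contraNneq pH => <-; apply: imset_f.
rewrite adj_sym in pa; rewrite adj_sym in pb.
case: (eqVneq a1 b1) => [e|ne1].
  rewrite -{}e in ab pb *; have [c /andP[ca cb]] := third_ord3 a2 b2.
  have ab2 : a2 != b2 by apply: contraNneq ab => ->.
  case/eqP: (pne (a1, c)); symmetry.
  by apply: (adj_common_unique srg _ pa pb);
    rewrite gadj /= eqxx ?[_ == c]eq_sym ?(negPf ca) ?(negPf cb) ?(negPf ab2).
case: (eqVneq a2 b2) => [e|ne2].
  rewrite -{}e in ab pb *; have [c /andP[ca cb]] := third_ord3 a1 b1.
  case/eqP: (pne (c, a2)); symmetry.
  by apply: (adj_common_unique srg _ pa pb);
    rewrite gadj /= eqxx ?[_ == c]eq_sym ?(negPf ca) ?(negPf cb) ?(negPf ne1).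
apply: (@no_three_common _ _ _ srg (g (a1, a2)) (g (b1, b2))
    (g (a1, b2)) (g (b1, a2)) p) => //;
  rewrite ?gne ?gadj //= ?eqxx ?[b1 == a1]eq_sym ?[b2 == a2]eq_sym
    ?(negPf ne1) ?(negPf ne2) //.
by rewrite xpair_eqE (negPf ne1).
Qed.

Lemma card_grid_neighbours a : #|neighbours (g a) :&: H| = 4.
Proof.
have -> : neighbours (g a) :&: H = g @: [set b | (a.1 == b.1) (+) (a.2 == b.2)].
  apply/setP => w; apply/idP/imsetP => [|[b + ->]].
    rewrite in_setI inE => /andP[+ /imsetP[b _ e]].
    by rewrite e gadj; exists b; rewrite ?inE.
  by rewrite inE => h; rewrite in_setI inE gadj h imset_f.
rewrite (card_imset _ grid_inj) -sum1dep_card big_mkcond /=.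
rewrite -(pair_bigA _ (fun i j : 'I_3 =>
  if (a.1 == i) (+) (a.2 == j) then 1 else 0)) /=.
rewrite !big_ord_recl !big_ord0.
by case: a => [[[|[|[|]]] //= ?] [[|[|[|]]] //= ?]].
Qed.

(** There are 9 * 10 edges leaving the grid and 90 vertices outside it, each of
    which receives at most one. *)
Lemma card_neighbours_in_grid p : p \notin H -> #|neighbours p :&: H| = 1.
Proof.
have le1 w : w \in ~: H -> #|neighbours w :&: H| <= 1.
  rewrite in_setC => wH; rewrite leqNgt; apply/negP => /card_gt1P[u [v [hu hv]]].
  move: hu hv; rewrite !in_setI ![_ \in neighbours w]inE.
  case/andP=> wu /imsetP[a _ e] /andP[wv /imsetP[b _ e']].
  rewrite e in wu *; rewrite e' in wv *.
  by rewrite (grid_neighbour_unique wH wu wv) eqxx.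
have tot : \sum_(w in ~: H) #|neighbours w :&: H| = #|~: H|.
  rewrite -(double_count H (~: H)).
  transitivity (\sum_(u in H) 10).
    apply: eq_bigr => _ /imsetP[a _ ->]; have := cardsID H (neighbours (g a)).
    by rewrite card_grid_neighbours (card_neighbours srg) setDE; lia.
  by have := cardsC H; rewrite sum_nat_const (card_conway srg) card_grid; lia.
move=> pH; have pC : p \in ~: H by rewrite in_setC.
apply/eqP; rewrite eqn_leq le1 //= -ltnS; move: tot; rewrite -[RHS]sum1_card.
rewrite (bigD1 p) // [RHS](bigD1 p) //= => e.
have : \sum_(i in ~: H | i != p) #|neighbours i :&: H| <=
    \sum_(i in ~: H | i != p) 1.
  by apply: leq_sum => w /andP[/le1].
lia.
Qed.

End Grid.

(** * Lines mapped to themselves by an automorphism of order three *)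
Lemma card_fix_mod3 (gT : finGroupType) (sT : finType)
    (to : {action gT &-> sT}) (x : gT) (S : {set sT}) :
  (x ^+ 3)%g = 1%g -> {in S, forall s, to s x \in S} ->
  #|S| = #|[set s in S | to s x == s]| %[mod 3].
Proof.
move=> x3 xS.
have px : (3.-group <[x]>)%g.
  by apply: pnat_dvd (pnat_id _) => //; rewrite -orderE order_dvdn x3.
have act : [acts <[x]>, on S | to]%g.
  by rewrite cycle_subG !inE; apply/subsetP => s sS; rewrite inE xS.
rewrite (pgroup_fix_mod px act) afix_cycle ?inE //.
by congr (_ %% _); apply: eq_card => s; rewrite !inE sub1set inE.
Qed.

Section OrderThree.
Variable G : sgraph.
Hypothesis srg : strongly_regular G 99 14 1 2.
Variable x : {perm G}.
Hypothesis xaut : x \in graph_aut G.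
Hypothesis x3 : (x ^+ 3)%g = 1%g.
Local Notation F := (fixed_vertices x).
Local Notation T := [set u : G | adj u (x u)].

Lemma xadj u v : adj (x u) (x v) = adj u v.
Proof. by move: xaut; rewrite inE => /forallP/(_ u)/forallP/(_ v)/eqP. Qed.

Lemma xK u : x (x (x u)) = u.
Proof.
by have /permP/(_ u) := x3; rewrite !expgS expg0 mulg1 !permM perm1.
Qed.

Lemma x_nfix u : x u != u -> [/\ x u != u, x (x u) != u & x (x u) != x u].
Proof.
move=> h; split=> //; last by rewrite (inj_eq perm_inj).
by apply: contra h => /eqP/(congr1 x); rewrite xK => {1}<-.
Qed.

Lemma T_adj u :
  u \in T -> [/\ adj u (x u), adj u (x (x u)) & adj (x u) (x (x u))].
Proof.
rewrite inE => h; split=> //; last by rewrite xadj.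
by rewrite adj_sym -xadj xK.
Qed.

Lemma T_stable u : (x u \in T) = (u \in T).
Proof. by rewrite !inE xadj. Qed.

Lemma T_nfix u : u \in T -> x u != u.
Proof. by rewrite inE eq_sym; exact: adj_neq. Qed.

Definition line (L : {set G}) :=
  (#|L| == 3) && [forall u in L, forall w in L, (u != w) ==> adj u w].

Lemma line_adj L u w : line L -> u \in L -> w \in L -> u != w -> adj u w.
Proof.
case/andP=> _ /forall_inP h uL wL.
by move/forall_inP: (h u uL) => /(_ w wL)/implyP.
Qed.

Lemma card_line L : line L -> #|L| = 3.
Proof. by case/andP => /eqP. Qed.

Lemma line_triple u w a : adj u w -> adj u a -> adj w a -> line [set u; w; a].
Proof.
move=> uw ua wa; have [[nuw nua] nwa] := (adj_neq uw, adj_neq ua, adj_neq wa).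
apply/andP; split.
  by rewrite -setUA cardsU1 cards2 !inE (negPf nuw) (negPf nua) nwa.
apply/forall_inP => b hb; apply/forall_inP => c hc; move: hb hc; rewrite !inE.
by case/orP=> [/orP[]|] /eqP->; case/orP=> [/orP[]|] /eqP->;
  rewrite ?eqxx //= ?uw ?ua ?wa ?implybT // adj_sym ?uw ?ua ?wa implybT.
Qed.

Lemma line_eq L u w a : line L -> adj u w -> adj u a -> adj w a ->
  u \in L -> w \in L -> L = [set u; w; a].
Proof.
move=> lL uw ua wa uL wL; have lA := line_triple uw ua wa.
apply/eqP; rewrite eqEcard !card_line // leqnn andbT.
apply/subsetP => b bL; rewrite !inE.
case: eqVneq => //= bu; case: eqVneq => //= bw; apply/eqP.
have ub : adj u b by apply: (line_adj lL) => //; rewrite eq_sym.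
have wb : adj w b by apply: (line_adj lL) => //; rewrite eq_sym.
exact: (adj_common_unique srg uw).
Qed.

Definition lines := [set L | line L].

Lemma card_offdiag (L : {set G}) : #|L| = 3 ->
  \sum_(u in L) \sum_(w in L) (u != w) = 6.
Proof.
move=> cL; transitivity (\sum_(u in L) 2); last by rewrite sum_nat_const cL.
apply: eq_bigr => u uL; rewrite (bigD1 u) //= eqxx add0n.
transitivity (\sum_(w in L :\ u) 1).
  rewrite [LHS]big_mkcond [RHS]big_mkcond /=; apply: eq_bigr => w _.
  by rewrite !inE andbC; case: eqVneq => //=; rewrite eq_sym => ->.
by rewrite sum1_card; move: cL; rewrite (cardsD1 u) uL => -[].
Qed.

(** Each of the 99 * 14 ordered edges lies in one line, each line holds 6. *)
Lemma card_lines : #|lines| = 231.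
Proof.
suff: #|lines| * 6 = 231 * 6 by move/eqP; rewrite eqn_mul2r => /eqP.
rewrite -sum_nat_const.
transitivity (\sum_(L in lines) \sum_u \sum_w
    ((u \in L) && (w \in L) && (u != w) : nat)).
  apply: eq_bigr => L; rewrite inE => lL.
  rewrite -(@card_offdiag L); last exact: card_line.
  rewrite big_mkcond; apply: eq_bigr => u _ /=.
  case: (u \in L) => /=; last by rewrite big1.
  by rewrite big_mkcond; apply: eq_bigr => w _ /=; case: (w \in L).
rewrite exchange_big /=; transitivity (\sum_(u : G) 14); last first.
  by rewrite sum_nat_const (card_conway srg).
apply: eq_bigr => u _; rewrite exchange_big /=.
rewrite -(card_neighbours srg u) -sum1_card.
rewrite [RHS]big_mkcond /=; apply: eq_bigr => w _; rewrite inE.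
case uw: (adj u w); last first.
  apply: big1 => L; rewrite inE => lL; apply/eqP; rewrite eqb0; apply/negP.
  by case/andP=> /andP[uL wL] /(line_adj lL uL wL); rewrite uw.
have [ua wa] := apexP srg uw; have lA := line_triple uw ua wa.
rewrite (bigD1 [set u; w; apex u w]) ?inE //= !eqxx orbT (adj_neq uw) /=.
rewrite big1 // => L; rewrite inE => /andP[lL]; apply: contraNeq.
rewrite eqb0 negbK.
by case/andP=> /andP[uL wL] _; apply/eqP/line_eq.
Qed.

Lemma fixed_lines_mod3 :
  #|[set L in lines | x @: L == L]| = 0 %[mod 3].
Proof.
have h L : setact 'P L x = x @: L by [].
have := @card_fix_mod3 _ _ ('P^*)%act x lines x3; rewrite card_lines.
move=> <- // L; rewrite !inE /= h => lL.
apply/andP; split; first by rewrite (card_imset _ (@perm_inj _ x)) (card_line lL).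
apply/forall_inP => _ /imsetP[u uL ->]; apply/forall_inP => _ /imsetP[w wL ->].
by apply/implyP; rewrite (inj_eq perm_inj) xadj; exact: line_adj lL uL wL.
Qed.

Lemma sum_fixed_lines :
  3 * #|[set L in lines | x @: L == L]| =
  \sum_(u : G) #|[set L in lines | (x @: L == L) && (u \in L)]|.
Proof.
rewrite mulnC -sum_nat_const.
transitivity (\sum_(L in [set L in lines | x @: L == L]) \sum_u (u \in L : nat)).
  apply: eq_bigr => L; rewrite !inE => /andP[/andP[/eqP<- _] _].
  by rewrite -sum1_card big_mkcond; apply: eq_bigr => u _; case: (u \in L).
rewrite exchange_big; apply: eq_bigr => u _ /=; rewrite -sum1_card.
rewrite big_mkcond [RHS]big_mkcond; apply: eq_bigr => L _ /=.
by rewrite !inE andbA; case: (line L && _); case: (u \in L).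
Qed.

(** A line mapped to itself contains the whole orbit of each of its vertices, so
    through a vertex that is not fixed only the orbit itself can be one. *)
Lemma fixed_lines_at u : u \notin F ->
  #|[set L in lines | (x @: L == L) && (u \in L)]| = (u \in T).
Proof.
rewrite fixed_verticesE => nu.
case uT: (u \in T); last first.
  apply/eqP; rewrite cards_eq0 -subset0; apply/subsetP => L; rewrite !inE.
  case/and3P=> lL /eqP xL uL; move: uT.
  rewrite inE (line_adj lL uL) // 1?eq_sym //.
  by rewrite -xL imset_f.
have [a b c] := T_adj uT; apply/eqP/cards1P; exists [set u; x u; x (x u)].
apply/setP => L; rewrite !inE; apply/and3P/eqP => [[lL /eqP xL uL]|->].
  by apply: line_eq => //; rewrite -xL imset_f.
split; [exact: line_triple | | by rewrite !inE eqxx].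
by rewrite !imsetU !imset_set1 xK setUC setUA.
Qed.

Lemma fixed_line_sub (L : {set G}) u :
  x @: L = L -> #|L| = 3 -> u \in L -> x u = u -> L \subset F.
Proof.
move=> xL cL uL xu; apply/subsetP => w wL.
rewrite fixed_verticesE; apply/negPn/negP => nw.
have [n1 n2 n3] := x_nfix nw.
have wu : u != w by apply: contraNneq nw => <-; apply/eqP.
have xwu : u != x w.
  by apply: contraNneq wu => e; rewrite -[w]xK -e !xu.
have xxwu : u != x (x w).
  by apply: contraNneq wu => e; rewrite -[w]xK -e xu.
have /subset_leq_card : [set u; w; x w; x (x w)] \subset L.
  apply/subsetP => a; rewrite !inE -!orbA => /or4P[]/eqP-> //.
    by rewrite -xL imset_f.
  by rewrite -xL imset_f // -xL imset_f.
rewrite cL -!setUA !cardsU1 cards1 !inE (negPf wu) (negPf xwu) (negPf xxwu).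
rewrite (eq_sym w (x w)) (eq_sym w (x (x w))) (eq_sym (x w) (x (x w))).
by rewrite (negPf n1) (negPf n2) (negPf n3).
Qed.

(** * The fixed vertices *)

(** Otherwise the orbit of v would consist of three common neighbours. *)
Lemma common_fixed u w v : u \in F -> w \in F -> u != w ->
  adj u v -> adj w v -> v \in F.
Proof.
rewrite !fixed_verticesE => /eqP xu /eqP xw uw uv wv; apply/negPn/negP => nv.
have [n1 n2 n3] := x_nfix nv.
have h a : x a = a -> adj a v -> adj a (x v) /\ adj a (x (x v)).
  by move=> xa av; split; rewrite -{1}xa xadj // -{1}xa xadj.
have [u1 u2] := h u xu uv; have [w1 w2] := h w xw wv.
by apply: (no_three_common srg uw uv wv u1 w1 u2 w2); rewrite eq_sym.
Qed.

Lemma card_fixed_neighbours_le1 v : v \notin F -> #|neighbours v :&: F| <= 1.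
Proof.
move=> vF; rewrite leqNgt; apply/negP => /card_gt1P[u [w [hu hw uw]]].
move: hu hw; rewrite !in_setI [u \in neighbours v]inE [w \in neighbours v]inE.
move=> /andP[vu uF] /andP[vw wF]; case/negP: vF.
by apply: (common_fixed uF wF uw); rewrite adj_sym.
Qed.

(** The fixed neighbours of u are paired by the lines through u, and x permutes
    the 14 neighbours of u. *)
Lemma fixed_valency u : u \in F -> #|neighbours u :&: F| \in [:: 2; 8; 14].
Proof.
move=> uF; have xu : x u = u by apply/eqP; rewrite -fixed_verticesE.
have e3 : 14 = #|neighbours u :&: F| %[mod 3].
  rewrite -(card_neighbours srg u) (@card_fix_mod3 _ _ 'P x) //.
    congr (_ %% _); apply: eq_card => v.
    by rewrite in_setI fixed_verticesE [LHS]inE.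
  by move=> v; rewrite !inE /= -{2}xu xadj.
have [I [_ _ _ [cl _]]] :=
  partner_transversal srg (subsetIl (neighbours u) F).
have {}cl : #|neighbours u :&: F| = 2 * #|I|.
  apply: cl => v; rewrite !in_setI inE => /andP[uv vF].
  have [ua va] := apexP srg uv.
  by rewrite inE ua (common_fixed uF vF (adj_neq uv)).
have := subset_leq_card (subsetIl (neighbours u) F).
rewrite (card_neighbours srg) !inE; move: e3; rewrite cl.
move=> e3 l14; have: #|I| <= 7 by lia.
by move: e3 {l14}; case: #|I| => [|[|[|[|[|[|[|[|]]]]]]]].
Qed.

Lemma edges_out_of_fixed :
  \sum_(u in F) #|neighbours u :\: F| = \sum_(v in ~: F) #|neighbours v :&: F|.
Proof.
by rewrite -(double_count F (~: F)); apply: eq_bigr => u _; rewrite setDE.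
Qed.

(** Once every fixed vertex has 8 fixed neighbours, there are at least 15 fixed
    vertices, each with 6 neighbours outside F, and no vertex outside F is
    joined to two of them: this needs at least 15 * 7 > 99 vertices. *)
Lemma fixed_set_empty_or_line : (x != 1)%g -> F = set0 \/ line F.
Proof.
move=> x1; case: (set_0Vmem F) => [|[u0 u0F]]; [by left | right].
have split u : #|neighbours u :&: F| + #|neighbours u :\: F| = 14.
  by rewrite -(card_neighbours srg u) cardsID.
case: (boolP [exists u in F, #|neighbours u :&: F| == 2]) => [|no2].
  case/exists_inP => u uF /cards2P[a [b [ab E]]].
  have : a \in [set a; b] by rewrite !inE eqxx.
  have : b \in [set a; b] by rewrite !inE eqxx orbT.
  rewrite -E !in_setI ![_ \in neighbours u]inE => /andP[ub bF] /andP[ua aF].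
  have [uc ac] := apexP srg ua.
  have adjab : adj a b.
    have: apex u a \in [set a; b].
      by rewrite -E in_setI inE uc (common_fixed uF aF (adj_neq ua)).
    rewrite !inE => /orP[] /eqP e; move: ac; rewrite e // adj_irrefl //.
  suff -> : F = [set u; a; b] by exact: line_triple.
  apply/eqP; rewrite eqEsubset; apply/andP; split; last first.
    by rewrite !subUset !sub1set uF aF.
  apply/subsetP => w wF; rewrite !in_setU !in_set1; case: eqVneq => //= wu.
  have inab c : adj u c -> c \in F -> (c == a) || (c == b).
    move=> h1 h2; have: c \in [set a; b]; last by rewrite !inE.
    by rewrite -E in_setI inE h1.
  case: (boolP (adj u w)) => [uw|nuw]; first exact: inab.
  rewrite eq_sym in wu.
  have [c [d [cd uC wC uD wD]]] := two_common srg wu nuw.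
  have ca := inab c uC (common_fixed uF wF wu uC wC).
  have da := inab d uD (common_fixed uF wF wu uD wD).
  suff [wa wb] : adj w a /\ adj w b.
    by case/eqP: wu; apply: (adj_common_unique srg adjab); rewrite // adj_sym.
  case/orP: ca cd wC => /eqP-> ; case/orP: da wD => /eqP->; rewrite ?eqxx //.
case: (boolP [exists u in F, #|neighbours u :&: F| == 14]) => [|no14].
  case/exists_inP => u uF /eqP e14; case/eqP: x1; apply/permP => w; rewrite perm1.
  have sub : neighbours u \subset F.
    have /eqP <- : neighbours u :&: F == neighbours u.
      by rewrite eqEcard subsetIl e14 (card_neighbours srg).
    exact: subsetIr.
  apply/eqP; rewrite -fixed_verticesE.
  case: (eqVneq u w) => [<-//|uw].
  case: (boolP (adj u w)) => [h|nuw]; first by apply: (subsetP sub); rewrite inE.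
  have [c [d [cd uC wC uD wD]]] := two_common srg uw nuw.
  apply: (@common_fixed c d) => //; rewrite 1?adj_sym //;
    by apply: (subsetP sub); rewrite inE.
exfalso.
have val8 u : u \in F -> #|neighbours u :&: F| = 8.
  move=> uF; have := fixed_valency uF; rewrite !inE.
  case/or3P => /eqP e //.
    by case/negP: no2; apply/exists_inP; exists u => //; apply/eqP.
  by case/negP: no14; apply/exists_inP; exists u => //; apply/eqP.
have [a aN] : exists a, a \in neighbours u0 :&: F.
  by apply/card_gt0P; rewrite val8.
move: aN; rewrite in_setI inE => /andP[ua aF].
(* To the 8 fixed neighbours of u0 add those fixed neighbours of a that are not
   adjacent to u0: all 8 of them, u0 included, except the common neighbour. *)
have F15 : 15 <= #|F|.
  have c7 : 7 <= #|(neighbours a :&: F) :\: neighbours u0|.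
    have := cardsID (neighbours u0) (neighbours a :&: F); rewrite val8 //.
    have : #|neighbours a :&: F :&: neighbours u0| <= 1.
      have <- : #|neighbours u0 :&: neighbours a| = 1.
        by rewrite (card_common srg) (negPf (adj_neq ua)) ua.
      apply/subset_leq_card/subsetP => w.
      by rewrite !in_setI => /andP[/andP[-> _] ->].
    by lia.
  have disj : [disjoint (neighbours u0 :&: F)
                      & (neighbours a :&: F) :\: neighbours u0].
    rewrite -setI_eq0 -subset0; apply/subsetP => w; rewrite !in_setI in_setD.
    by case/andP => /andP[-> _].
  have : #|(neighbours u0 :&: F) :|: ((neighbours a :&: F) :\: neighbours u0)|
      <= #|F|.
    apply/subset_leq_card.
    by rewrite subUset subsetIr subDset subsetU // subsetIr orbT.
  have := leq_card_setU (neighbours u0 :&: F)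
    ((neighbours a :&: F) :\: neighbours u0).
  by rewrite disj => -[_ /eqP->]; rewrite val8 //; lia.
have : \sum_(u in F) #|neighbours u :\: F| = #|F| * 6.
  rewrite -sum_nat_const; apply: eq_bigr => u uF.
  by have := split u; rewrite val8 //; lia.
have : \sum_(v in ~: F) #|neighbours v :&: F| <= #|~: F|.
  rewrite -sum1_card; apply: leq_sum => v; rewrite in_setC.
  exact: card_fixed_neighbours_le1.
rewrite -edges_out_of_fixed => h e; move: h; rewrite e.
by have := cardsC F; rewrite (card_conway srg); lia.
Qed.

(** * The possible values of a_1 *)

(** Counting incident pairs of a vertex and a line mapped to itself, a vertex
    of T or of F is on one such line and any other vertex on none. *)
Lemma card_T_fixed_mod9 : F = set0 \/ line F -> #|T| + #|F| = 0 %[mod 9].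
Proof.
move=> hF; pose n := #|[set L in lines | x @: L == L]|.
suff e : #|T| + #|F| = 3 * n.
  have := fixed_lines_mod3; rewrite -/n e => h.
  by rewrite (_ : 9 = 3 * 3) // -muln_modr h.
rewrite sum_fixed_lines -!sum1_card [\sum_(i in T) 1]big_mkcond.
rewrite [\sum_(i in F) 1]big_mkcond -big_split; apply: eq_bigr => u _ /=.
case: (boolP (u \in F)) => uF; last first.
  by rewrite fixed_lines_at // addn0; case: (u \in T).
have xu : x u = u by apply/eqP; rewrite -fixed_verticesE.
case: hF => [F0|lF]; first by rewrite F0 inE in uF.
have -> : (u \in T) = false by rewrite inE xu adj_irrefl.
apply/esym/eqP/cards1P; exists F; apply/setP => L; rewrite in_set1 !inE.
apply/and3P/eqP => [[lL /eqP xL uL]|->].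
  apply/eqP; rewrite eqEcard !card_line // leqnn andbT.
  exact: (fixed_line_sub xL (card_line lL) uL xu).
split=> //; rewrite eqEcard (card_imset _ (@perm_inj _ x)) leqnn andbT.
apply/subsetP => _ /imsetP[w wF ->]; move: (wF).
rewrite !fixed_verticesE => /eqP->.
by move: wF; rewrite fixed_verticesE.
Qed.

Lemma a1_of_fixed_empty : F = set0 -> a1 x = 18 \/ a1 x = 81.
Proof.
move=> F0; have := trace_mod7 srg xaut; have := card_T_fixed_mod9 (or_introl F0).
rewrite F0 cards0 addn0 -/(a1 x) => h9 h7.
have: a1 x <= 99 by rewrite -(card_conway srg) max_card.
by lia.
Qed.

(** The congruences leave 6 and 69. Each fixed vertex has 12 neighbours outside
    F; these 36 vertices are distinct. None is in T: a fixed neighbour would be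
    a second common neighbour of the vertex and its image, besides the third
    point of the orbit. *)
Lemma a1_of_fixed_line : line F -> a1 x = 6.
Proof.
move=> lF; have c3 := card_line lF.
have := trace_mod7 srg xaut; have := card_T_fixed_mod9 (or_intror lF).
rewrite c3 -/(a1 x) => h9 h7.
suff: a1 x <= 60 by lia.
have e : \sum_(u in F) #|neighbours u :\: F| = 36.
  transitivity (\sum_(u in F) 12); last by rewrite sum_nat_const c3.
  apply: eq_bigr => u uF.
  have := cardsID F (neighbours u); rewrite (card_neighbours srg).
  suff -> : neighbours u :&: F = F :\ u.
    by move: c3; rewrite (cardsD1 u) uF; lia.
  apply/setP => w; rewrite in_setD1 in_setI inE.
  case: (boolP (w \in F)) => [wF|]; last by rewrite !andbF.
  rewrite !andbT; apply/idP/idP => [/adj_neq|h]; first by rewrite eq_sym.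
  by apply: (line_adj lF) => //; rewrite eq_sym.
have : 36 <= #|~: F :\: T|.
  rewrite -e edges_out_of_fixed -sum1_card big_mkcond [in leqRHS]big_mkcond /=.
  apply: leq_sum => v _; rewrite in_setD in_setC.
  case: (boolP (v \in F)) => vF; rewrite ?andbF //= andbT.
  case: (boolP (v \in T)) => [vT|_]; last exact: card_fixed_neighbours_le1.
  rewrite leqn0 cards_eq0 -subset0; apply/subsetP => u; rewrite in_setI inE.
  rewrite fixed_verticesE => /andP[vu /eqP xu]; have [t1 t2 t3] := T_adj vT.
  have u1 : adj (x v) u by rewrite -xu xadj.
  have e' : u = x (x v) by apply: (adj_common_unique srg t1).
  by move: vu; rewrite -xu e' xK adj_irrefl.
have TF : T \subset ~: F.
  by apply/subsetP => v /T_nfix; rewrite in_setC fixed_verticesE.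
rewrite cardsD (setIidPr TF) -/(a1 x).
by have := cardsC F; rewrite (card_conway srg) c3; lia.
Qed.

Lemma line_induced_iso (L : {set G}) :
  line L -> graph_iso (induced L) (complete 3).
Proof.
move=> lL; have c3 : #|{: {u | u \in L}}| = 3 by rewrite card_sig card_line.
pose f (u : induced L) : complete 3 :=
  cast_ord c3 (enum_rank (u : {u | u \in L})).
exists f.
  exists (fun i : 'I_3 => enum_val (cast_ord (esym c3) i)) => i.
    by rewrite /f cast_ordK enum_rankK.
  by rewrite /f enum_valK cast_ordKV.
move=> u w; rewrite /= /complete_adj /f (inj_eq (@cast_ord_inj _ _ _)).
rewrite (inj_eq enum_rank_inj) /induced_adj; apply/idP/idP => [h|/adj_neq].
  by apply: (line_adj lL (valP u) (valP w)); rewrite val_eqE.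
by rewrite val_eqE.
Qed.

(** * Orbits in T *)
Definition same_orbit u v := [|| v == u, v == x u | v == x (x u)].
Definition meets u v := [|| adj u v, adj u (x v) | adj u (x (x v))].

Lemma x_eq u v : (x u == x v) = (u == v).
Proof. exact: (inj_eq perm_inj). Qed.

Lemma same_xr u v : same_orbit u (x v) = same_orbit u v.
Proof. by rewrite /same_orbit !x_eq -{1}(xK u) !x_eq orbC -orbA. Qed.

Lemma same_xl u v : same_orbit (x u) v = same_orbit u v.
Proof. by rewrite /same_orbit xK [RHS]orbC -orbA. Qed.

Lemma same_sym u v : same_orbit u v = same_orbit v u.
Proof.
rewrite /same_orbit ![v == _]eq_sym; congr (_ || _).
by rewrite -[x u == v]x_eq -[x (x u) == v]x_eq xK -x_eq xK orbC.
Qed.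

Lemma touch_xr u v : meets u (x v) = meets u v.
Proof. by rewrite /meets xK orbA orbC. Qed.

Lemma touch_xl u v : meets (x u) v = meets u v.
Proof. by rewrite -touch_xr /meets !xadj. Qed.

Lemma same_touch_r u v w : same_orbit v w -> meets u w = meets u v.
Proof. by case/or3P => /eqP ->; rewrite ?touch_xr. Qed.

Lemma same_touch_l u v w : same_orbit u v -> meets v w = meets u w.
Proof. by case/or3P => /eqP ->; rewrite ?touch_xl. Qed.

(** The orbit of v is a line, and a vertex off a line has at most one neighbour
    on it. *)
Lemma orbit_neighbour_unique u v : v \in T -> ~~ same_orbit v u -> adj u v ->
  ~~ adj u (x v) /\ ~~ adj u (x (x v)).
Proof.
move=> vT ns uv; have [t1 t2 t3] := T_adj vT; rewrite adj_sym in uv.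
split; apply: contra ns => h; rewrite adj_sym in h; rewrite /same_orbit.
  by rewrite (adj_common_unique srg t1 uv h t2 t3) eqxx !orbT.
by rewrite (adj_common_unique srg t2 uv h t1 _) ?eqxx ?orbT // adj_sym.
Qed.

Local Notation K := (orbit_kernel x).

Lemma orbit_kernel_diag u : u \in T -> K u u = 12%R.
Proof.
move=> uT; have [t1 t2 _] := T_adj uT; have [n1 n2 _] := x_nfix (T_nfix uT).
rewrite /orbit_kernel /kernel t1 t2 adj_irrefl eqxx.
by rewrite ![u == _]eq_sym (negPf n1) (negPf n2).
Qed.

Lemma orbit_kernelE u v : v \in T -> ~~ same_orbit v u ->
  K u v = (if meets u v then - 6%:R else 3%:R)%R.
Proof.
move=> vT ns; have /norP[n1 /norP[n2 n3]] := ns.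
rewrite /orbit_kernel /kernel (negPf n1) (negPf n2) (negPf n3) /meets.
case: (boolP (adj u v)) => [h|_].
  by have [/negPf-> /negPf->] := orbit_neighbour_unique vT ns h.
case: (boolP (adj u (x v))) => [h|_].
  have [|||/negPf-> _] := @orbit_neighbour_unique u (x v) => //.
    by rewrite T_stable.
  by rewrite same_xl.
by case: (adj u _).
Qed.

(** * Excluding 81 vertices adjacent to their image *)
Section Grid81.
Hypothesis free : forall u, x u != u.
Hypothesis card81 : #|T| = 81.

Section TransversalLine.
Variable p : 'I_3 -> G.
Hypothesis pT : forall r, p r \in T.
Hypothesis p_adj : forall r r', r != r' -> adj (p r) (p r').
Hypothesis p_same : forall r r', r != r' -> ~~ same_orbit (p r) (p r').

(* The rows of this grid are the orbits of the p r. *)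
Let g (a : 'I_3 * 'I_3) := iter a.2 x (p a.1).
Local Notation H := [set g a | a : 'I_3 * 'I_3].

Lemma orbit_grid_adj a b : adj (g a) (g b) = (a.1 == b.1) (+) (a.2 == b.2).
Proof.
case: a b => [r c] [r' c'] /=; rewrite /g /=; case: (eqVneq r r') => [<-|ne].
  have [t1 t2 t3] := T_adj (pT r).
  case: c c' => [[|[|[|//]]] /= ?] [[|[|[|//]]] /= ?];
    by rewrite ?adj_irrefl // adj_sym.
have h1 := p_adj ne; have h2 := p_same ne; rewrite same_sym in h2.
have [/negPf n1 /negPf n2] := orbit_neighbour_unique (pT r') h2 h1.
rewrite adj_sym in h1; rewrite same_sym in h2.
have [/negPf m1 /negPf m2] := orbit_neighbour_unique (pT r) h2 h1.
rewrite adj_sym in h1.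
by case: c c' => [[|[|[|//]]] /= ?] [[|[|[|//]]] /= ?];
  rewrite ?xadj // adj_sym ?xadj.
Qed.

Let le1 := grid_neighbour_unique srg orbit_grid_adj.

Lemma same_row a b : same_orbit (g a) (g b) = (a.1 == b.1).
Proof.
have sameg u v (c c' : nat) :
    same_orbit (iter c x u) (iter c' x v) = same_orbit u v.
  elim: c => [|c IH]; last by rewrite iterS same_xl.
  by elim: c' => //= c' <-; rewrite same_xr.
rewrite /g sameg; case: eqVneq => [->|/p_same/negPf //].
by rewrite /same_orbit eqxx.
Qed.

Lemma grid_T a : g a \in T.
Proof. by rewrite /g; elim: (val a.2) => //= n; rewrite T_stable. Qed.

Lemma grid_x w : w \in H -> x w \in H.
Proof.
case/imsetP => -[r c] _ ->; rewrite /g /=.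
have e i (lt : i < 3) : iter i x (p r) \in H.
  by apply/imsetP; exists (r, Ordinal lt).
by case: c => [[|[|[|//]]] /= ?]; rewrite ?xK ?(e 0) ?(e 1) ?(e 2).
Qed.

Lemma grid_same w w' : same_orbit w w' -> (w' \in H) = (w \in H).
Proof.
have hx v : (x v \in H) = (v \in H).
  by apply/idP/idP => [h|]; [rewrite -(xK v); do 2!apply: grid_x | exact: grid_x].
by case/or3P => /eqP ->; rewrite ?hx.
Qed.

Lemma notin_grid_same a w :
  w \notin H -> ~~ same_orbit w (g a) /\ ~~ same_orbit (g a) w.
Proof.
move=> wH; suff h : ~~ same_orbit w (g a) by rewrite [same_orbit (g a) w]same_sym.
by apply: contra wH => /grid_same <-; exact: imset_f.
Qed.

Definition outer a := (neighbours (g a) :&: T) :\: H.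

Lemma outerP a w : reflect [/\ adj (g a) w, w \in T & w \notin H] (w \in outer a).
Proof.
rewrite in_setD in_setI [w \in neighbours _]inE.
by apply: (iffP and3P) => [[]|[]] *; split.
Qed.

Lemma card_T_outside : #|T :\: H| = 72.
Proof.
have sub : H \subset T by apply/subsetP => _ /imsetP[a _ ->]; exact: grid_T.
by rewrite cardsD (setIidPr sub) (card_grid orbit_grid_adj) card81.
Qed.

(** The vertices of a row have at most 3 * 14 = 42 neighbours, and 72 vertices
    of T lie outside the grid. *)
Lemma remote_T a : exists q, [/\ q \in T, q \notin H & ~~ meets q (g a)].
Proof.
case: (pickP (fun q => (q \in T :\: H) && ~~ meets q (g a))) => [q|none].
  by rewrite in_setD => /andP[/andP[? ?] ?]; exists q.
have sub : T :\: H \subset neighbours (g a) :|: (neighbours (x (g a))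
    :|: neighbours (x (x (g a)))).
  apply/subsetP => q qT; have := none q; rewrite qT => /negbT; rewrite negbK.
  by rewrite !inE ![adj _ q]adj_sym.
have := subset_leq_card sub; rewrite card_T_outside.
have leU (A B : {set G}) : #|A :|: B| <= #|A| + #|B| by rewrite cardsU leq_subr.
have := leU (neighbours (g a))
  (neighbours (x (g a)) :|: neighbours (x (x (g a)))).
have := leU (neighbours (x (g a))) (neighbours (x (x (g a)))).
by rewrite !(card_neighbours srg); lia.
Qed.

(** With h the grid vertex, q a vertex of T that is not joined to the row of h,
    and k the vertex of the column of h in the row that q is joined to, the
    values of [orbit_kernel] are those required by [bessel_bound]. *)
Lemma outer_independent a (I : {set G}) : I \subset outer a ->
  {in I &, forall w w', ~~ adj w w'} -> #|I| <= 4.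
Proof.
move=> /subsetP IO indep; pose h := g a.
have [q [qT qH qh]] := remote_T a.
have [b qb] : exists b, adj q (g b).
  have /eqP/cards1P[w e] := card_neighbours_in_grid srg orbit_grid_adj qH.
  have : w \in [set w] by rewrite inE.
  rewrite -e in_setI inE => /andP[qw /imsetP[b _ e']]; exists b; by rewrite -e'.
have row : a.1 != b.1.
  apply: contra qh; rewrite -same_row => /same_touch_r <-.
  by rewrite /meets qb.
pose k := g (b.1, a.2).
have hk : adj h k by rewrite orbit_grid_adj /= (negPf row) eqxx.
have kq : meets q k.
  have s : same_orbit (g b) k by rewrite same_row.
  by rewrite (same_touch_r q s) /meets qb.
have [hT kT] : h \in T /\ k \in T by rewrite !grid_T.
have nsh w : w \notin H -> ~~ same_orbit w h /\ ~~ same_orbit h w.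
  exact: notin_grid_same.
have nsk w : w \notin H -> ~~ same_orbit w k /\ ~~ same_orbit k w.
  exact: notin_grid_same.
apply: (@bessel_bound _ K h k q I); rewrite ?orbit_kernel_diag //.
- exact: (orbit_kernel_psd srg xadj xK).
- exact: (orbit_kernel_sym xadj xK).
- by rewrite orbit_kernelE // ?same_row 1?eq_sym // /meets hk.
- by rewrite orbit_kernelE ?kq //; case: (nsk q qH).
- by rewrite orbit_kernelE ?(negPf qh) //; case: (nsh q qH).
- move=> w /IO/outerP[hw wT wH]; split.
  + by rewrite orbit_kernelE // ?/meets ?hw //; case: (nsh w wH).
  + rewrite (orbit_kernel_sym xadj xK) orbit_kernelE //; last by case: (nsk w wH).
    have kH : k \in H by exact: imset_f.
    have no u : u \in H -> same_orbit k u -> ~~ adj w u.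
      case/imsetP => c _ -> s; apply/negP => wc; rewrite adj_sym in hw.
      by move: s row; rewrite (le1 wH wc hw) same_row /= eq_sym => ->.
    rewrite /meets (negPf (no k kH _)) ?(negPf (no (x k) _ _))
      ?(negPf (no (x (x k)) _ _)) //;
      by rewrite ?grid_x ?same_xr // /same_orbit eqxx.
  + rewrite orbit_kernelE //; first by case: meets; [left | right].
    apply: contra qh => s; rewrite (same_touch_l _ s).
    by rewrite /meets adj_sym hw.
move=> w w' wI w'I; case: eqVneq => [<-|ww'].
  by rewrite orbit_kernel_diag //; have /outerP[] := IO _ wI.
have /outerP[hw wT wH] := IO _ wI; have /outerP[hw' w'T w'H] := IO _ w'I.
have [sh _] := nsh w' w'H.
have [/negPf n1 /negPf n2] := orbit_neighbour_unique w'T sh hw'.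
have ns : ~~ same_orbit w' w.
  apply/negP => /or3P[] /eqP e; last by rewrite -e hw in n2.
    by rewrite e eqxx in ww'.
  by rewrite -e hw in n1.
rewrite orbit_kernelE // /meets (negPf (indep _ _ wI w'I)) /=.
have [t1 t2 t3] := T_adj hT; have [t1' t2' t3'] := T_adj w'T.
have hH : h \in H by exact: imset_f.
have neH u v : u \in H -> v \notin H -> u != v.
  by move=> uH; apply: contraNneq => <-.
have xw'H : x w' \notin H by apply: contra w'H => /grid_x/grid_x; rewrite xK.
have xxw'H : x (x w') \notin H by apply: contra w'H => /grid_x; rewrite xK.
(* Otherwise h and the image of w' have the three common neighbours x h, w'
   and w. *)
have far1 : ~~ adj w (x w').
  apply/negP => c; rewrite adj_sym in c.
  apply: (no_three_common srg (neH h (x w') hH xw'H) t1 _ hw' _ hw c).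
  - by rewrite ?xadj adj_sym.
  - by rewrite adj_sym.
  - by apply: neH w'H; rewrite ?grid_x.
  - by apply: neH wH; rewrite ?grid_x.
  - by rewrite eq_sym.
have far2 : ~~ adj w (x (x w')).
  apply/negP => c; rewrite adj_sym in c.
  apply: (no_three_common srg (neH h (x (x w')) hH xxw'H) t2 _ hw' _ hw c).
  - by rewrite ?xadj adj_sym.
  - by rewrite adj_sym.
  - by apply: neH w'H; rewrite ?grid_x.
  - by apply: neH wH; rewrite ?grid_x.
  - by rewrite eq_sym.
by rewrite (negPf far1) (negPf far2).
Qed.

(** The nine sets have at most 8 elements and cover the 72 vertices of T outside
    the grid; a set of 8 with independent subsets of size at most 4 is a union
    of four pairs. *)
Lemma outer_saturated a :
  #|outer a| = 8 /\ {in outer a, forall w, apex (g a) w \in outer a}.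
Proof.
have sub b : outer b \subset neighbours (g b).
  by apply/subsetP => w /outerP[hw _ _]; rewrite inE.
have le8 b : #|outer b| <= 8.
  have [I [IO indep cI _]] := partner_transversal srg (sub b).
  by have := outer_independent IO indep; lia.
have tot : \sum_b #|outer b| = 72.
  rewrite -card_T_outside.
  transitivity (\sum_(u in H) #|neighbours u :&: (T :\: H)|).
    rewrite big_imset /=; last first.
      by move=> b c _ _; exact: (grid_inj orbit_grid_adj).
    by apply: eq_bigr => b _; rewrite /outer setIDA.
  rewrite (double_count H (T :\: H)) -sum1_card; apply: eq_bigr => w.
  rewrite in_setD => /andP[wH _].
  exact: (card_neighbours_in_grid srg orbit_grid_adj wH).
have e8 : #|outer a| = 8.
  apply/eqP; rewrite eqn_leq le8 /=; move: tot; rewrite (bigD1 a) //= => tot.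
  have : \sum_(b | b != a) #|outer b| <= \sum_(b | b != a) 8 by apply: leq_sum.
  have := cardC1 a; rewrite sum_nat_const card_prod card_ord /= => ->.
  lia.
split=> //; have [I [IO indep cI [_ cl]]] := partner_transversal srg (sub a).
by apply: cl; have := outer_independent IO indep; lia.
Qed.

Lemma no_transversal_line : False.
Proof.
pose a : 'I_3 * 'I_3 := (ord0, ord0); pose h := g a.
have hT : h \in T by exact: grid_T.
have hH : h \in H by exact: imset_f.
have [c8 closed] := outer_saturated a.
(* Of the 14 neighbours of h, 4 are in the grid and 8 in T outside it; Z
   consists of the remaining two, which form a line with h. *)
pose Z := (neighbours h :\: T) :\: H.
have hZ w : (w \in Z) = [&& w \notin H, w \notin T & adj h w].
  by rewrite !in_setD [w \in neighbours _]inE.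
have cZ : #|Z| = 2.
  have := cardsID H (neighbours h); rewrite (card_neighbours srg).
  have := card_grid_neighbours orbit_grid_adj a; rewrite -/h => ->.
  have := cardsID T (neighbours h :\: H).
  rewrite setIDAC -/(outer a) c8.
  have -> : neighbours h :\: H :\: T = Z by rewrite /Z setDDl setUC -setDDl.
  by lia.
have nbrH w u v :
  w \notin H -> u \in H -> v \in H -> adj w u -> adj w v -> u = v.
  by move=> wH /imsetP[b _ ->] /imsetP[c _ ->] wb wc; rewrite (le1 wH wb wc).
have mateZ z : z \in Z -> apex h z \in Z.
  rewrite !hZ => /and3P[zH zT hz]; have [ha za] := apexP srg hz.
  have aH : apex h z \notin H.
    apply/negP => aH.
    have e : h = apex h z by apply: (nbrH z); rewrite // adj_sym.
    by rewrite -e adj_irrefl in ha.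
  rewrite aH ha andbT; apply: contra zT => aT.
  have /closed : apex h z \in outer a by apply/outerP.
  by rewrite (apexK srg hz) => /outerP[].
have xH w : (x w \in H) = (w \in H).
  by apply: grid_same; rewrite same_xr /same_orbit eqxx.
(* The vertices h and x z are not adjacent; besides x h they have one more
   common neighbour, and it can only be the other element of Z. *)
have cross z : z \in Z -> adj (apex h z) (x z).
  move=> zZ; have aZ := mateZ z zZ; move: (zZ) (aZ); rewrite !hZ.
  case/and3P => zH zT hz /and3P[aH aT ha].
  have hxz : h != x z by apply: contraNneq zH => e; rewrite -xH -e.
  have [t1 t2 t3] := T_adj hT.
  have nhxz : ~~ adj h (x z).
    apply/negP => c; have e : h = x h.
      by apply: (nbrH (x z)); rewrite ?xH // adj_sym // xadj.
    by case/eqP: (free h).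
  have xhxz : adj (x z) (x h) by rewrite xadj adj_sym.
  have [b [bxh hb xzb]] := other_common srg hxz nhxz t1 xhxz.
  have bH : b \notin H.
    by apply: contra bxh => bH; apply/eqP; apply: (nbrH (x z)); rewrite ?xH.
  have bT : b \notin T.
    apply/negP => bT; have [s1 _ _] := T_adj bT.
    rewrite eq_sym in bxh.
    apply: (@no_three_common _ _ _ srg (x h) b h (x b) (x z));
      rewrite // ?xadj //.
    - by rewrite adj_sym.
    - by rewrite adj_sym.
    - by rewrite adj_sym.
    - by apply: contraNneq bH => e; rewrite -xH -e.
    by apply: contraNneq zT => e; rewrite -T_stable -e T_stable.
  have bZ : b \in Z by rewrite hZ bH bT.
  have : b \in [set z; apex h z].
    suff -> : [set z; apex h z] = Z by [].
    apply/eqP; rewrite eqEcard subUset !sub1set zZ aZ cZ cards2.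
    by have [_ /adj_neq ->] := apexP srg hz.
  rewrite !inE => /orP[] /eqP e; last by rewrite -e adj_sym.
  by case/negP: zT; rewrite inE -{1}e adj_sym.
have [z zZ] : exists z, z \in Z by apply/card_gt0P; rewrite cZ.
have hz : adj h z by move: zZ; rewrite hZ => /and3P[].
pose z' := apex h z.
have c1 : adj z' (x z) := cross z zZ.
have c2 : adj z' (x (x z)).
  have := cross _ (mateZ z zZ); rewrite (apexK srg hz) -/z'.
  by rewrite adj_sym -xadj -xadj xK.
have [_ c0] := apexP srg hz; rewrite -/z' in c0.
have [n1 n2 n3] := x_nfix (free z').
have d1 : adj z (x z') by rewrite adj_sym; have := c2; rewrite -xadj xK.
have d2 : adj z (x (x z')) by rewrite adj_sym; have := c1; rewrite -xadj -xadj xK.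
apply: (@no_three_common _ _ _ srg z (x z) z' (x z') (x (x z')));
  rewrite ?xadj // 1?eq_sym ?free //.
by rewrite adj_sym.
Qed.

End TransversalLine.

(** Suppose that no line has its vertices in three different orbits of T. Then
    each neighbour of u in T outside its orbit is paired, by a line through u,
    with a neighbour outside T. So at least 6 of the 14 neighbours of u are
    outside T, and 81 * 6 edges would have to reach 18 vertices of
    valency 14. *)
Lemma card_T_neq81 : False.
Proof.
have ge6 u : u \in T -> 6 <= #|neighbours u :&: ~: T|.
  move=> uT; have [t1 t2 t3] := T_adj uT.
  pose A := (neighbours u :&: T) :\: [set x u; x (x u)].
  have AP v : v \in A -> [/\ adj u v, v \in T, v != x u & v != x (x u)].
    rewrite in_setD in_setI !in_set2 negb_or [v \in neighbours _]inE.
    by case/andP=> /andP[? ?] /andP[? ?].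
  have c2 : #|neighbours u :&: T| = #|A| + 2.
    rewrite /A -(cardsID [set x u; x (x u)] (neighbours u :&: T)) addnC.
    congr (_ + _).
    have /setIidPr -> : [set x u; x (x u)] \subset neighbours u :&: T.
      rewrite subUset !sub1set !in_setI !T_stable uT.
      by rewrite ![_ \in neighbours _]inE t1 t2.
    by rewrite cards2 eq_sym; have [_ _ ->] := x_nfix (T_nfix uT).
  have := cardsID T (neighbours u); rewrite (card_neighbours srg) c2 setDE.
  suff: #|A| <= #|neighbours u :&: ~: T| by lia.
  have inj : {in A &, injective (apex u)}.
    move=> v w /AP[uv _ _ _] /AP[uw _ _ _] e.
    by rewrite -(apexK srg uv) e (apexK srg uw).
  rewrite -(card_in_imset inj).
  apply/subset_leq_card/subsetP => _ /imsetP[v vA ->].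
  have [uv vT vxu vxxu] := AP v vA; have [ua va] := apexP srg uv.
  rewrite in_setI in_setC [_ \in neighbours _]inE ua; apply/negP => aT.
  have suv : ~~ same_orbit u v.
    by rewrite /same_orbit !negb_or vxu vxxu !andbT eq_sym adj_neq.
  have svu : ~~ same_orbit v u by rewrite same_sym.
  have vu : adj v u by rewrite adj_sym.
  have [nv1 nv2] := orbit_neighbour_unique vT svu uv.
  have [nu1 nu2] := orbit_neighbour_unique uT suv vu.
  have sua : ~~ same_orbit u (apex u v).
    apply/or3P => -[] /eqP e; [move: ua | move: va nu1 | move: va nu2];
      by rewrite e ?adj_irrefl // => ->.
  have sva : ~~ same_orbit v (apex u v).
    apply/or3P => -[] /eqP e; [move: va | move: ua nv1 | move: ua nv2];
      by rewrite e ?adj_irrefl // => ->.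
  apply: (@no_transversal_line (fun r => nth u [:: u; v; apex u v] r)).
  - by case=> [[|[|[|]]]].
  - by case=> [[|[|[|//]]] ?] [[|[|[|//]]] ?] //= _; rewrite // adj_sym.
  - by case=> [[|[|[|//]]] ?] [[|[|[|//]]] ?] //= _; rewrite // same_sym.
have := double_count T (~: T).
have : \sum_(u in T) #|neighbours u :&: ~: T| >= 81 * 6.
  by rewrite -card81 -sum_nat_const; apply: leq_sum.
have : \sum_(w in ~: T) #|neighbours w :&: T| <= 18 * 14.
  have <- : #|~: T| = 18.
    by have := cardsC T; rewrite card81 (card_conway srg); lia.
  rewrite -sum_nat_const; apply: leq_sum => w _.
  by rewrite -(card_neighbours srg w) subset_leq_card // subsetIl.
lia.
Qed.

End Grid81.
End OrderThree.

Local Open Scope group_scope.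

Theorem proposition8p7 (Delta : sgraph)
    (hDelta : strongly_regular Delta 99 14 1 2)
    (x : {perm Delta}) (hx : x \in graph_aut Delta) (hord : #[x] = 3) :
  (fixed_vertices x = set0 /\ a1 x = 18) \/
  (graph_iso (fixed_graph x) (complete 3) /\ a1 x = 6).
Proof.
have x3 : x ^+ 3 = 1 by rewrite -hord expg_order.
have x1 : x != 1 by rewrite -order_gt1 hord.
case: (fixed_set_empty_or_line hDelta hx x3 x1) => [F0 | lF];
  [left | right]; split=> //.
- case: (a1_of_fixed_empty hDelta hx x3 F0) => // e81; exfalso.
  apply: (card_T_neq81 hDelta hx x3 _ e81) => u.
  by rewrite -fixed_verticesE F0 inE.
- exact: line_induced_iso.
- exact: a1_of_fixed_line.
Qed.
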